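(* Assume that $|f(x,y)-f(x,y')|\le L_f\|y-y'\|$ for all $x\in\mathbb{R}^{n_x}$, $y,y'\in\mathbb{R}^{n_y}$ with $L_f>0$ independent of $x$, that $F$ is Lipschitz continuous with constant $L_F$, and that the set $\mathcal{L}_\varepsilon=\{x\in\mathbb{R}^{n_x}: F(x)\le F(x_0)+2L_f\varepsilon\}$ is bounded. Let $\{x_k\}$, $\{\alpha_k\}$, $\{\Delta_k\}$, $\{D_k\}$ be generated by the inexact mesh-based direct-search algorithm described in the context with $\alpha_{\min}>0$, and let $K$ be an (infinite) subset of the indices of unsuccessful iterations. Assume that: - $\lim_{k\in K}x_k=\bar x$; - $\lim_{k\in K}\alpha_k=0$; - $\{\hat D_k\}_{k\in K}$ is dense in the unit sphere, where $\hat D_k=\{d/\|d\|: d\in D_k\}$ (that is, $\bigcup_{k\in K}\hat D_k$ is dense in the unit sphere of $\mathbb{R}^{n_x}$); - for all $k$ and all $d\in D_k$, $\frac{\Delta_k}{\alpha_k}b_1(\alpha_k)\le\|d\|\le\frac{\Delta_k}{\alpha_k}b_2(\alpha_k)$, where $b_1,b_2:\mathbb{R}_{>0}\to\mathbb{R}_{>0}$ satisfy $\lim_{t\to0}b_i(t)=1$ for $i\in\{1,2\}$. Then the limit point $\bar x$ of $\{x_k\}_{k\in K}$ is $(\delta,\epsilon)$-Goldstein stationary for $F$, with $$\epsilon=\frac{4L_f\varepsilon}{\alpha_{\min}}\qquad\text{and}\qquad\delta=\alpha_{\min}.$$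
   Context: Bilevel setting. $f:\mathbb{R}^{n_x}\times\mathbb{R}^{n_y}\to\mathbb{R}$ is continuous, $g:\mathbb{R}^{n_x}\times\mathbb{R}^{n_y}\to\mathbb{R}$, $Z\subset\mathbb{R}^{n_y}$. For every $x\in\mathbb{R}^{n_x}$, $\arg\min_{z\in Z} g(x,z)=\{y(x)\}$ is a singleton. The true objective is $F(x):=f(x,y(x))$. A fixed oracle $\tilde y:\mathbb{R}^{n_x}\to\mathbb{R}^{n_y}$ satisfies $\|\tilde y(x)-y(x)\|\le\varepsilon$ for all $x$, where $\varepsilon>0$ is a fixed constant, and $\tilde F(x):=f(x,\tilde y(x))$. A positive spanning set of $\mathbb{R}^{n}$ is a finite set of vectors whose nonnegative linear combinations are all of $\mathbb{R}^n$. Inexact mesh-based direct-search algorithm (nonsmooth variant, no termination test); $n=n_x$. Parameters: $x_0\in\mathbb{R}^{n}$, lower bound $\alpha_{\min}$, $\theta\in(0,1)\cap\mathbb{Q}$, $\mu_0\in\mathbb{N}_0$, initial mesh size $\alpha_0=\alpha_{\min}\theta^{-\mu_0}$, initial frame size $\Delta_0=\alpha_0$, $G\in\mathbb{R}^{n\times n}$ invertible, $\mathcal Z\in\mathbb{Z}^{n\times p}$ with columns forming a positive spanning set, and $D=G\mathcal Z$. At iteration $k=0,1,2,\dots$, let $M_k=\{x_k+\alpha_kDy: y\in\mathbb{N}^p\}$ be the mesh. (i) Search (optional): choose a finite $S_k\subset M_k$; if $\tilde F(t)<\tilde F(x_k)$ for some $t\in S_k$, set $x_{k+1}=t$ for such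 a $t$, declare the iteration successful and skip the poll step. (ii) Poll: otherwise choose a positive spanning set $D_k$ with $\{x_k+\alpha_kd: d\in D_k\}\subset M_k$; if some $d_k\in D_k$ has $\tilde F(x_k+\alpha_kd_k)<\tilde F(x_k)$, set $x_{k+1}=x_k+\alpha_kd_k$ for such a $d_k$ and declare the iteration successful; otherwise set $x_{k+1}=x_k$ and declare it unsuccessful. (iii) Update: if successful, $\Delta_{k+1}=\theta^{-1}\Delta_k$ and $\alpha_{k+1}=\min(\Delta_{k+1},\Delta_{k+1}^2)$; if unsuccessful, $\Delta_{k+1}=\max\{\alpha_{\min},\theta\Delta_k\}$ and $\alpha_{k+1}=\min(\Delta_k,\Delta_k^2,\theta\alpha_k)$. Goldstein stationarity. For locally Lipschitz $F$, $\partial F$ denotes the Clarke subdifferential, $B_\delta(x)$ the (closed) ball of radius $\delta$ centered at $x$, and $\partial_\delta F(x)=\mathrm{conv}\big(\bigcup_{y\in B_\delta(x)}\partial F(y)\big)$. A point $x$ is $(\delta,\epsilon)$-Goldstein stationary for $F$ if there is $g\in\partial_\delta F(x)$ with $\|g\|\le\epsilon$. *)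

(* Defs.v *)
From mathcomp Require Import all_boot all_order all_algebra.
From mathcomp Require Import finmap.
From mathcomp Require Import all_classical all_reals all_analysis.

Set Implicit Arguments.
Unset Strict Implicit.
Unset Printing Implicit Defensive.

Import Order.TTheory GRing.Theory Num.Theory.
Import numFieldNormedType.Exports.

Local Open Scope fset_scope.
Local Open Scope classical_set_scope.
Local Open Scope ring_scope.

Section euclidean_space.
Context {R : realType}.
Implicit Types n : nat.

Definition edot n (u v : 'cV[R]_n) : R := \sum_i u i 0 * v i 0.

(* The library's norm on matrices is the sup norm; its topology is the usual
   one on R^n, so limits and closures below are taken from the library. *)
Definition enorm n (u : 'cV[R]_n) : R := Num.sqrt (edot u u).

Definition eclosed_ball n (x : 'cV[R]_n) (r : R) : set 'cV[R]_n :=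
  [set y | enorm (y - x) <= r].

Definition eunit_sphere n : set 'cV[R]_n := [set v | enorm v = 1].

Definition ebounded n (A : set 'cV[R]_n) : Prop :=
  exists M : R, forall x, A x -> enorm x <= M.

Definition positive_spanning n (D : {fset 'cV[R]_n}) : Prop :=
  forall v, exists2 c : 'cV[R]_n -> R,
    (forall d, d \in D -> 0 <= c d) & v = \sum_(d <- D) c d *: d.

Definition argmin_on {T : Type} (h : T -> R) (Z : set T) : set T :=
  [set z | Z z /\ forall w, Z w -> h z <= h w].

Definition objective n m (f : 'cV[R]_n * 'cV[R]_m -> R)
    (s : 'cV[R]_n -> 'cV[R]_m) : 'cV[R]_n -> R :=
  fun u => f (u, s u).

End euclidean_space.

Arguments eunit_sphere R n : clear implicits.

Section goldstein.
Context {R : realType} {n : nat}.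
Implicit Types (F : 'cV[R]_n -> R) (x v : 'cV[R]_n).

(* F°(x; v), the limsup of (F (z + t v) - F z) / t as z --> x and t --> 0+. *)
Definition clarke_derivative F x v : \bar R :=
  limf_esup
    (fun p : 'cV[R]_n * R => ((F (p.1 + p.2 *: v) - F p.1) / p.2)%:E)
    (filter_prod (nbhs x) 0^'+).

Definition clarke_subdifferential F x : set 'cV[R]_n :=
  [set xi | forall v, ((edot xi v)%:E <= clarke_derivative F x v)%E].

Definition convex_hull (A : set 'cV[R]_n) : set 'cV[R]_n :=
  smallest (@convex_set R 'cV[R]_n) A.

Definition goldstein_subdifferential F (delta : R) x : set 'cV[R]_n :=
  convex_hull (\bigcup_(z in eclosed_ball x delta) clarke_subdifferential F z).

Definition goldstein_stationary F (delta epsilon : R) x : Prop :=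
  exists2 xi, goldstein_subdifferential F delta x xi & enorm xi <= epsilon.

End goldstein.

Section direct_search.
Context {R : realType} {n : nat}.
Implicit Types (Ft : 'cV[R]_n -> R) (x : 'cV[R]_n) (alpha : R).

Definition mesh p (D : 'M[R]_(n, p)) x alpha : set 'cV[R]_n :=
  [set x + alpha *: (D *m map_mx (fun k => k%:R) m) | m in [set: 'cV[nat]_p]].

Definition search_success Ft x (S : {fset 'cV[R]_n}) : Prop :=
  exists2 t, t \in S & Ft t < Ft x.

Definition poll_success Ft x alpha (D : {fset 'cV[R]_n}) : Prop :=
  exists2 d, d \in D & Ft (x + alpha *: d) < Ft x.

Definition polled Ft (x : nat -> 'cV[R]_n) (S : nat -> {fset 'cV[R]_n})
    (k : nat) : Prop :=
  ~ search_success Ft (x k) (S k).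

Definition unsuccessful Ft (x : nat -> 'cV[R]_n) (alpha : nat -> R)
    (S D : nat -> {fset 'cV[R]_n}) (k : nat) : Prop :=
  polled Ft x S k /\ ~ poll_success Ft (x k) (alpha k) (D k).

(* An omitted search is S k = fset0. When the search succeeds no poll set is
   chosen: D k is then an unconstrained dummy. *)
Record direct_search_run p Ft (x0 : 'cV[R]_n) (alpha_min : R) (theta : rat)
    (mu0 : nat) (G : 'M[R]_n) (Zm : 'M[int]_(n, p))
    (x : nat -> 'cV[R]_n) (alpha Delta : nat -> R)
    (S D : nat -> {fset 'cV[R]_n}) : Prop := DirectSearchRun {
  run_theta : 0 < theta < 1;
  run_G : G \in unitmx;
  run_Zm : positive_spanning
             [fset (col j (map_mx intr Zm) : 'cV[R]_n) | j in 'I_p];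
  run_x0 : x 0%N = x0;
  run_alpha0 : alpha 0%N = alpha_min * (ratr theta ^+ mu0)^-1;
  run_Delta0 : Delta 0%N = alpha 0%N;
  run_search_mesh : forall k t, t \in S k ->
    mesh (G *m map_mx intr Zm) (x k) (alpha k) t;
  run_search : forall k, search_success Ft (x k) (S k) ->
    exists2 t, t \in S k & Ft t < Ft (x k) /\ x k.+1 = t;
  run_poll_spanning : forall k, polled Ft x S k -> positive_spanning (D k);
  run_poll_mesh : forall k, polled Ft x S k -> forall d, d \in D k ->
    mesh (G *m map_mx intr Zm) (x k) (alpha k) (x k + alpha k *: d);
  run_poll : forall k, polled Ft x S k ->
    poll_success Ft (x k) (alpha k) (D k) ->
    exists2 d, d \in D k &
      Ft (x k + alpha k *: d) < Ft (x k) /\ x k.+1 = x k + alpha k *: d;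
  run_stay : forall k, unsuccessful Ft x alpha S D k -> x k.+1 = x k;
  run_update_success : forall k, ~ unsuccessful Ft x alpha S D k ->
    Delta k.+1 = (ratr theta)^-1 * Delta k /\
    alpha k.+1 = Num.min (Delta k.+1) (Delta k.+1 ^+ 2);
  run_update_failure : forall k, unsuccessful Ft x alpha S D k ->
    Delta k.+1 = Num.max alpha_min (ratr theta * Delta k) /\
    alpha k.+1 =
      Num.min (Num.min (Delta k) (Delta k ^+ 2)) (ratr theta * alpha k)
}.

Definition normalized_directions (D : {fset 'cV[R]_n}) : set 'cV[R]_n :=
  [set (enorm d)^-1 *: d | d in [set` D]].

End direct_search.

(* Main.v *)
(* Suppose that xbar is not Goldstein stationary. The Goldstein subdifferential
   is a bounded nonempty convex set of vectors of norm > epsilon, so some unit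
   vector v satisfies <xi, v> <= - 3 epsilon / 4 on it. Clarke derivatives are
   sublinear, hence (finite-dimensional Hahn-Banach) attained by subgradients,
   so that all Clarke derivatives in direction v are <= - 3 epsilon / 4 on the
   ball of radius delta = alpha_min; integrating along v gives
     F (xbar + alpha_min v) < F xbar - epsilon alpha_min / 2
                            = F xbar - 2 Lf eps.
   The algorithm forbids this. Since iterates stay in a bounded set and the mesh
   is a lattice, frame sizes are bounded, and then Delta k = alpha_min as soon as
   alpha k is small. Unsuccessful polls along K therefore compare F, up to an
   error of 2 Lf eps, at x k and at a point close to xbar + alpha_min v. *)
Require Import Defs.
From mathcomp Require Import all_boot all_order all_algebra.
From mathcomp Require Import finmap.
From mathcomp Require Import all_classical all_reals all_analysis.
From mathcomp Require Import ring lra.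

Import Order.TTheory GRing.Theory Num.Theory.
Import numFieldNormedType.Exports.

Local Open Scope classical_set_scope.
Local Open Scope ring_scope.

Set Implicit Arguments.
Unset Strict Implicit.

(** * Euclidean inner product and norm, compared with the sup norm *)

Section euclidean_space.
Context {R : realType} {n : nat}.
Implicit Types (u v w : 'cV[R]_n) (c : R).

Lemma edotC u v : edot u v = edot v u.
Proof. by apply: eq_bigr => i _; rewrite mulrC. Qed.

Lemma edotDl u v w : edot (u + v) w = edot u w + edot v w.
Proof. by rewrite -big_split; apply: eq_bigr => i _; rewrite mxE mulrDl. Qed.

Lemma edotZl c u v : edot (c *: u) v = c * edot u v.
Proof. by rewrite mulr_sumr; apply: eq_bigr => i _; rewrite mxE mulrA. Qed.

Lemma edotDr u v w : edot u (v + w) = edot u v + edot u w.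
Proof. by rewrite edotC edotDl !(edotC _ u). Qed.

Lemma edotZr c u v : edot u (c *: v) = c * edot u v.
Proof. by rewrite edotC edotZl edotC. Qed.

Lemma edotNr u v : edot u (- v) = - edot u v.
Proof. by rewrite -scaleN1r edotZr mulN1r. Qed.

Lemma edotNl u v : edot (- u) v = - edot u v.
Proof. by rewrite edotC edotNr edotC. Qed.

Lemma edot0r u : edot u 0 = 0.
Proof. by rewrite -(scale0r 0) edotZr mul0r. Qed.

Lemma edot_ge0 u : 0 <= edot u u.
Proof. by apply: sumr_ge0 => i _; rewrite -expr2 sqr_ge0. Qed.

Lemma enorm_ge0 u : 0 <= enorm u.
Proof. exact: sqrtr_ge0. Qed.

Lemma enorm_sqr u : enorm u ^+ 2 = edot u u.
Proof. by rewrite sqr_sqrtr// edot_ge0. Qed.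

Lemma enormZ c u : enorm (c *: u) = `|c| * enorm u.
Proof.
by rewrite /enorm edotZl edotZr mulrA -expr2 sqrtrM ?sqr_ge0// sqrtr_sqr.
Qed.

Lemma enormN u : enorm (- u) = enorm u.
Proof. by rewrite -scaleN1r enormZ normrN1 mul1r. Qed.

Lemma coord_le_enorm u i : `|u i 0| <= enorm u.
Proof.
rewrite -sqrtr_sqr ler_sqrt ?edot_ge0// /edot (bigD1 i)//= -expr2 lerDl.
by apply: sumr_ge0 => j _; rewrite -expr2 sqr_ge0.
Qed.

Lemma enorm_eq0 u : enorm u = 0 -> u = 0.
Proof.
move=> u0; apply/colP => i; rewrite mxE; apply/eqP.
by rewrite -normr_le0 -u0 coord_le_enorm.
Qed.

Lemma edot_le_enorm u v : edot u v <= enorm u * enorm v.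
Proof.
have [/enorm_eq0 ->|u0] := eqVneq (enorm u) 0.
  by rewrite edotC edot0r mulr_ge0// enorm_ge0.
have [/enorm_eq0 ->|v0] := eqVneq (enorm v) 0.
  by rewrite edot0r mulr_ge0// enorm_ge0.
have up : 0 < enorm u by rewrite lt_def u0 enorm_ge0.
have vp : 0 < enorm v by rewrite lt_def v0 enorm_ge0.
have := edot_ge0 (enorm v *: u - enorm u *: v).
rewrite !(edotDl, edotDr, edotNl, edotNr, edotZl, edotZr) -!enorm_sqr (edotC v u).
move=> h; rewrite -(ler_pM2l (mulr_gt0 up vp)); nra.
Qed.

Lemma enormD u v : enorm (u + v) <= enorm u + enorm v.
Proof.
rewrite -(@ler_pXn2r _ 2)// ?nnegrE ?addr_ge0 ?enorm_ge0//.
rewrite enorm_sqr edotDl !edotDr -!enorm_sqr (edotC v u).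
by have := edot_le_enorm u v; lra.
Qed.

Lemma normr_le_enorm u : `|u| <= enorm u.
Proof.
rewrite [leLHS]/Num.Def.normr /= mx_normrE; apply/bigmax_leP; split=> [|[i j] _].
  exact: enorm_ge0.
by rewrite (ord1 j) coord_le_enorm.
Qed.

(** The crude factor [n.+1] stands in for the square root of [n]; it is positive in every dimension,
    so one can divide by it. *)
Lemma enorm_le_normr u : enorm u <= n.+1%:R * `|u|.
Proof.
rewrite -(@ler_pXn2r _ 2)// ?nnegrE ?mulr_ge0 ?enorm_ge0// enorm_sqr.
apply: (@le_trans _ _ (n%:R * `|u| ^+ 2)).
  rewrite /edot -[n in n%:R]card_ord -sum1_card natr_sum mulr_suml.
  apply: ler_sum => i _; rewrite mul1r -expr2 -real_normK ?num_real//.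
  rewrite lerXn2r ?nnegrE//.
  rewrite [leRHS]/Num.Def.normr /= mx_normrE.
  exact: (le_bigmax _ (fun ij => `|u ij.1 ij.2|) (i, 0)).  
rewrite exprMn ler_wpM2r ?sqr_ge0// -natrX ler_nat.
by rewrite (leq_trans (leqnSn n))// leq_pmulr.
Qed.

End euclidean_space.

(** * Sublinear functions and finite-dimensional Hahn-Banach *)

Section sublinear.
Context {R : realType} {V : lmodType R}.
Implicit Types (p q : V -> R) (u v a : V).

(** One inequality suffices for homogeneity: at the inverse scalar it gives the other one, and
    scaling by 2 then fixes the value at [0]. *)
Definition sublinear p : Prop :=
  (forall c v, 0 < c -> p (c *: v) <= c * p v) /\
  (forall u v, p (u + v) <= p u + p v).

Lemma sublinearZ p c v : sublinear p -> 0 < c -> p (c *: v) = c * p v.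
Proof.
move=> [pZ _] c0; apply/eqP; rewrite eq_le pZ//=.
by rewrite -ler_pdivlMl// (le_trans _ (pZ _ _ _)) ?invr_gt0// scalerK ?gt_eqF.
Qed.

Lemma sublinear0 p : sublinear p -> p 0 = 0.
Proof.
by move=> sp; have := sublinearZ 0 sp (ltr0Sn _ 1); rewrite scaler0; lra.
Qed.

Lemma sublinear_oppr_ge p v : sublinear p -> - p v <= p (- v).
Proof.
by move=> sp; have := sp.2 v (- v); rewrite subrr sublinear0//; lra.
Qed.

(** Oddness at [a] leaves a smaller sublinear function no room there, so linearity gained along a
    vector survives further minorization. *)
Lemma sublinear_oddS p q a : sublinear q -> (forall v, q v <= p v) ->
  p (- a) = - p a -> q a = p a /\ q (- a) = - q a.
Proof.
move=> sq qp pa; have := sublinear_oppr_ge a sq.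
by have := qp a; have := qp (- a); rewrite pa; lra.
Qed.

(* Minimality trick behind the Hahn-Banach theorem: this minorant is the
   directional derivative at infinity of [p] along [a]. *)
Lemma sublinear_minorant p a : sublinear p ->
  exists q, [/\ sublinear q, forall v, q v <= p v, q a = p a
    & q (- a) = - q a].
Proof.
move=> sp.
pose E v := [set p (v + t *: a) - t * p a | t in [set t : R | 0 <= t]].
pose q v := inf (E v).
(* Subadditivity for [t *: a = (v + t *: a) - v]. *)
have Elb v : lbound (E v) (- p (- v)).
  move=> _ [t /= t0 <-]; rewrite lerNl opprB lerBlDl.
  have [->|tn0] := eqVneq t 0.
    by rewrite scale0r mul0r addr0; have := sublinear_oppr_ge v sp; lra.
  rewrite -sublinearZ ?lt_def ?tn0//.
  by apply: le_trans (sp.2 _ _); rewrite addrAC subrr add0r.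
have Einf v : has_inf (E v).
  by split; [exists (p (v + 0 *: a) - 0 * p a), 0 => //=|exists (- p (- v))].
have q_le v t : 0 <= t -> q v <= p (v + t *: a) - t * p a.
  by move=> t0; apply: ge_inf; [exact: (Einf v).2|exists t].
have le_q v x : (forall t, 0 <= t -> x <= p (v + t *: a) - t * p a) -> x <= q v.
  move=> h; apply: lb_le_inf; [exact: (Einf v).1|].
  by move=> _ [t /= t0 <-]; exact: h.
have sq : sublinear q.
  split=> [c v c0|u v].
    rewrite -ler_pdivrMl//; apply: (le_q _ _ _) => t t0.
    rewrite ler_pdivrMl// mulrBr -(sublinearZ (v + _) sp c0) scalerDr mulrA scalerA.
    by apply: q_le; rewrite mulr_ge0// ltW.
  (* Independent parameters [s] for [u] and [t] for [v] combine into [s + t] for [u + v]. *)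
  rewrite -lerBlDr; apply: (le_q _ _ _) => s s0; rewrite lerBlDr -lerBlDl.
  apply: (le_q _ _ _) => t t0; rewrite lerBlDl.
  have := sp.2 (u + s *: a) (v + t *: a); rewrite addrACA -scalerDl.
  by have := q_le (u + v) (s + t) (addr_ge0 s0 t0); lra.
have qp v : q v <= p v.
  by have := q_le v 0 (lexx _); rewrite scale0r addr0 mul0r subr0.
have qNa : q (- a) <= - p a.
  have := q_le (- a) 1 ler01.
  by rewrite scale1r addNr sublinear0// mul1r sub0r.
by have := sublinear_oppr_ge a sq; have := qp a; exists q; split=> //; lra.
Qed.

Lemma sublinear_minorant_seq p (s : seq V) : sublinear p ->
  exists q, [/\ sublinear q, forall v, q v <= p v
    & forall a, a \in s -> q (- a) = - q a].
Proof.
move=> sp; elim: s => [|a s [q [sq qp qs]]]; first by exists p; split.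
have [r [sr rq ra rNa]] := sublinear_minorant a sq.
exists r; split=> // [v|b]; first exact: le_trans (rq v) (qp v).
by rewrite inE => /predU1P[->//|/qs/(sublinear_oddS sr rq)[]].
Qed.

End sublinear.

(** A first minorant is made odd at [a] with value [p a], then a smaller one odd along every basis
    vector. The latter is linear, and its coefficients form [xi]. *)
Lemma sublinear_support {R : realType} {n : nat} (p : 'cV[R]_n -> R) a :
  sublinear p ->
  exists2 xi, (forall v, edot xi v <= p v) & edot xi a = p a.
Proof.
move=> sp; have [p1 [sp1 p1p p1a p1Na]] := sublinear_minorant a sp.
have [q [sq qp1 qe]] :=
  sublinear_minorant_seq (codom (fun i => delta_mx i 0 : 'cV[R]_n)) sp1.
have [qa qNa] := sublinear_oddS sq qp1 p1Na.
pose xi := \col_i q (delta_mx i 0).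
have qZ i c : q (c *: delta_mx i 0) = c * q (delta_mx i 0).
  have qNe : q (- delta_mx i 0) = - q (delta_mx i 0).
    by apply: qe; apply/codomP; exists i.
  have [c0|c0|->] := ltgtP c 0; last 1 first.
  - by rewrite scale0r mul0r sublinear0.
  - by rewrite -(opprK c) scaleNr -scalerN sublinearZ ?oppr_gt0// qNe; ring.
  - by rewrite sublinearZ.
have q_le v : q v <= edot xi v.
  have -> : v = \sum_i v i 0 *: delta_mx i 0.
    by rewrite {1}(matrix_sum_delta v); apply: eq_bigr => i _; rewrite big_ord1.
  apply: (@le_trans _ _ (\sum_i q (v i 0 *: delta_mx i 0))).
    elim/big_rec2: _ => [|i y1 y2 _ h]; first by rewrite sublinear0.
    by apply: le_trans (sq.2 _ _) _; rewrite lerD2l.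
  rewrite le_eqVlt; apply/orP; left; apply/eqP.
  apply: eq_bigr => i _; rewrite qZ mxE summxE (bigD1 i)//= big1 => [|j ji].
    by rewrite !mxE !eqxx mulr1 addr0 mulrC.
  by rewrite !mxE eq_sym (negbTE ji) mulr0.
(* The reverse bound is [q_le] at [- v]. *)
have xi_le v : edot xi v <= q v.
  by have := q_le (- v); have := sublinear_oppr_ge v sq; rewrite edotNr; lra.
exists xi => [v|]; first by rewrite (le_trans (xi_le v))// (le_trans (qp1 v)).
by rewrite -p1a -qa; apply/eqP; rewrite eq_le xi_le q_le.
Qed.

(** * Clarke derivatives and subdifferentials of Lipschitz functions *)

Section clarke.
Context {R : realType} {n : nat}.
Implicit Types (F : 'cV[R]_n -> R) (x u v w xi : 'cV[R]_n) (c e t : R).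

(** This lemma and the next unfold the limsup into bounds on difference quotients, one radius [e]
    controlling both base point and step. *)
Lemma clarke_derivative_lt F x v c : (clarke_derivative F x v < c%:E)%E ->
  exists2 e, 0 < e & forall z t, `|z - x| < e -> 0 < t < e ->
    (F (z + t *: v) - F z) / t <= c.
Proof.
rewrite /clarke_derivative limf_esupE.
move=> /ereal_inf_lt[_ [W [[A B] /= [xA B0] ABW] <-]] Wc.
have [d /= d0 dA] := (nbhs_normP x _).1 xA.
have [e /= e0 eB] := (nbhs_normP (0 : R) _).1 B0.
exists (Num.min d e) => [|z t]; first by rewrite lt_min d0.
rewrite !lt_min => /andP[zd ze] /and3P[t0 td te].
rewrite -lee_fin (le_trans _ (ltW Wc))//; apply: ereal_sup_ubound.
exists (z, t) => //; apply: ABW; split => /=.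
  by apply: dA; rewrite /ball_/= distrC.
by apply: eB => //; rewrite /ball_/= sub0r normrN gtr0_norm.
Qed.

Lemma clarke_derivative_le F x v c e : 0 < e ->
  (forall z t, `|z - x| < e -> 0 < t < e ->
    (F (z + t *: v) - F z) / t <= c) ->
  (clarke_derivative F x v <= c%:E)%E.
Proof.
move=> e0 h; rewrite /clarke_derivative limf_esupE.
pose W := [set p : 'cV[R]_n * R | `|p.1 - x| < e /\ 0 < p.2 < e].
apply: ge_ereal_inf; exists (ereal_sup ((fun p : 'cV[R]_n * R =>
    ((F (p.1 + p.2 *: v) - F p.1) / p.2)%:E) @` W)); last first.
  by apply: ge_ereal_sup => _ [[z t] /= [zx te] <-]; rewrite lee_fin h.
exists W => //; exists ([set z | `|z - x| < e], [set t | 0 < t < e]) => /=.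
  split; first by apply: (nbhs_normP x _).2; exists e => //= z /=; rewrite distrC.
  near=> t; apply/andP; split; first by near: t; exact: nbhs_right_gt.
  by near: t; exact: nbhs_right_lt.
by move=> [z t] [].
Unshelve. all: by end_near. Qed.

Section lipschitz.
Variables (F : 'cV[R]_n -> R) (L : R).
Hypotheses (L0 : 0 <= L) (FL : forall u v, `|F u - F v| <= L * enorm (u - v)).

Lemma lipschitz_quotient x v t : 0 < t ->
  `|(F (x + t *: v) - F x) / t| <= L * enorm v.
Proof.
move=> t0; rewrite normrM normfV (gtr0_norm t0) ler_pdivrMr//.
by apply: le_trans (FL _ _) _; rewrite addrC addKr enormZ gtr0_norm// mulrCA mulrC.
Qed.

Lemma clarke_derivative_bound x v :
  ((- (L * enorm v))%:E <= clarke_derivative F x v <= (L * enorm v)%:E)%E.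
Proof.
apply/andP; split; last first.
  apply: (clarke_derivative_le ltr01) => z t _ /andP[t0 _].
  by have /ler_normlP[] := lipschitz_quotient z v t0.
rewrite leNgt; apply/negP => Fc.
have [c Fc' cL] : exists2 c, (clarke_derivative F x v < c%:E)%E & c < - (L * enorm v).
  move: Fc; case: clarke_derivative => [r| |]//=.
    by rewrite lte_fin => rL; exists ((r - L * enorm v) / 2); rewrite ?lte_fin; lra.
  by move=> _; exists (- (L * enorm v) - 1); rewrite ?ltNyr//; lra.
(* The quotient at [x] itself with step [e / 2] already contradicts the Lipschitz bound. *)
have [e e0 /(_ x (e / 2))] := clarke_derivative_lt Fc'.
rewrite subrr normr0 => /(_ e0) h.
have /ler_normlP[+ _] := lipschitz_quotient x v (divr_gt0 e0 (ltr0Sn R 1)).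
by move: h; lra.
Qed.

Lemma clarke_derivative_fin x v : clarke_derivative F x v \is a fin_num.
Proof.
have /andP[h1 h2] := clarke_derivative_bound x v.
by rewrite fin_numElt (lt_le_trans _ h1) ?ltNyr// (le_lt_trans h2) ?ltry.
Qed.

Let F' x v := fine (clarke_derivative F x v).

Let F'E x v : clarke_derivative F x v = (F' x v)%:E.
Proof. by rewrite fineK// clarke_derivative_fin. Qed.

(** Homogeneity is the change of step [t * c]. For subadditivity, the quotient along [u + v] is
    split at [z + t *: u], which still tends to [x] because base points vary in the limsup. *)
Lemma clarke_derivative_sublinear x : sublinear (F' x).
Proof.
split=> [c v c0|u v].
  rewrite -ler_pdivrMl//; apply/ler_addgt0Pr => d d0; rewrite ler_pdivrMl//.
  have [|e e0 h] := @clarke_derivative_lt F x v (F' x v + d).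
    by rewrite F'E lte_fin ltrDl.
  rewrite -lee_fin -F'E; apply: (@clarke_derivative_le _ _ _ _ (Num.min e (e / c))).
    by rewrite lt_min e0 divr_gt0.
  move=> z t; rewrite !lt_min !(ltr_pdivlMr _ _ c0).
  move=> /andP[ze _] /and3P[t0 _ tce].
  have := h z (t * c) ze; rewrite mulr_gt0// => /(_ tce).
  by rewrite scalerA invfM mulrA ler_pdivrMr// (mulrC c).
apply/ler_addgt0Pr => d d0.
have [|e1 e10 h1] := @clarke_derivative_lt F x u (F' x u + d / 2).
  by rewrite F'E lte_fin; lra.
have [|e2 e20 h2] := @clarke_derivative_lt F x v (F' x v + d / 2).
  by rewrite F'E lte_fin; lra.
have u1 : 0 < 1 + `|u| by have := normr_ge0 u; lra.
(* The halves of [e2] bound [z - x] and [t *: u], which keeps [z + t *: u] within [e2] of [x]. *)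
pose e := Num.min (Num.min e1 (e2 / 2)) (Num.min e2 (e2 / 2 / (1 + `|u|))).
rewrite -lee_fin -F'E; apply: (@clarke_derivative_le _ _ _ _ e).
  by rewrite /e !lt_min e10 e20 !divr_gt0.
move=> z t; rewrite /e !lt_min !(ltr_pdivlMr _ _ u1).
move=> /andP[/andP[ze1 ze2] _] /and3P[t0 /andP[te1 _] /andP[te2 te2u]].
have := h1 z t ze1; rewrite t0 => /(_ te1).
have := h2 (z + t *: u) t; rewrite t0 => /(_ _ te2) h.
have {}h := h _.
rewrite scalerDr [z + (_ + _)]addrA.
suff : `|z + t *: u - x| < e2.
  by move=> /h; rewrite !mulrBl; lra.
rewrite addrAC (le_lt_trans (ler_normD _ _))// normrZ gtr0_norm//.
by have := normr_ge0 u; nra.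
Qed.

Lemma clarke_subdifferential_support x v :
  exists2 xi, clarke_subdifferential F x xi
    & (edot xi v)%:E = clarke_derivative F x v.
Proof.
have [xi xi_le xiE] := sublinear_support v (clarke_derivative_sublinear x).
by exists xi; [move=> w|]; rewrite F'E ?lee_fin ?xiE.
Qed.

(** Testing [xi] against itself bounds its squared norm by [L * enorm xi]. *)
Lemma clarke_subdifferential_bound x xi :
  clarke_subdifferential F x xi -> enorm xi <= L.
Proof.
move=> /(_ xi) h; have /andP[_ /(le_trans h)] := clarke_derivative_bound x xi.
rewrite lee_fin -enorm_sqr expr2.
have [->//|xi0] := eqVneq (enorm xi) 0.
by rewrite ler_pM2r// lt_def xi0 enorm_ge0.
Qed.

End lipschitz.
End clarke.

(** A continuation argument: the times satisfying the linear bound contain their supremum since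
    [phi] is Lipschitz, and the local decrease pushes that supremum up to [d]. *)
Lemma right_decrease_bound {R : realType} (phi : R -> R) (M c d : R) :
  0 < d -> 0 <= M -> (forall s t, `|phi s - phi t| <= M * `|s - t|) ->
  (forall t, 0 <= t < d -> exists2 e, 0 < e &
    forall h, 0 < h < e -> phi (t + h) - phi t <= - c * h) ->
  phi d - phi 0 <= - c * d.
Proof.
move=> d0 M0 phiM h.
pose A := [set t | 0 <= t <= d /\ phi t - phi 0 <= - c * t].
have A0 : A 0 by split; [rewrite lexx ltW|rewrite subrr mulr0].
have As : has_sup A.
  by split; [exists 0|exists d => t [/andP[_ ->]]].
pose s := sup A.
have s0 : 0 <= s by apply: ub_le_sup A0; exact: As.2.
have sd : s <= d by apply: ge_sup => [|t [/andP[]]]; first exact: As.1.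
have As' : A s.
  split; first exact/andP.
  apply/ler_addgt0Pr => e e0.
  (* Passing from a nearby [t] in [A] to [s] costs at most [(M + |c|) * (s - t)], whatever the sign
     of [c]. *)
  have k0 : 0 < M + `|c| + 1 by have := normr_ge0 c; lra.
  have [t At ts] := sup_adherent (divr_gt0 e0 k0) As.
  have ts' : t <= s by apply: ub_le_sup => //; exact: As.2.
  have /ler_normlP[_] := phiM s t; rewrite ger0_norm ?subr_ge0// => h1.
  have {}ts : (s - t) * (M + `|c| + 1) <= e.
    by rewrite -ler_pdivlMr//; move: ts; rewrite -/s; lra.
  have cn := ler_norm c.
  by case: At => _; nra.
suff -> : d = s by case: As'.
apply/eqP; rewrite eq_le sd andbT leNgt; apply/negP => ltsd.
have [|e e0 he] := h s; first by rewrite s0.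
pose k := Num.min e (d - s) / 2.
have m0 : 0 < Num.min e (d - s) by rewrite lt_min e0 subr_gt0.
have ke : Num.min e (d - s) <= e by rewrite ge_min lexx.
have kd : Num.min e (d - s) <= d - s by rewrite ge_min lexx orbT.
have k0 : 0 < k by rewrite /k; lra.
suff : A (s + k).
  move=> Ask; suff : s + k <= s by lra.
  by apply: ub_le_sup => //; exact: As.2.
split; first by rewrite /k; lra.
have [_ /=] := As'; have := he k; rewrite k0.
by move=> /(_ ltac:(rewrite /k; lra)); lra.
Qed.

(** * Goldstein subdifferentials and descent directions *)

Section goldstein.
Context {R : realType} {n : nat}.
Implicit Types (A : set 'cV[R]_n) (x u v xi zeta : 'cV[R]_n).

Lemma convex_hull_segment A xi zeta (t : R) : 0 <= t <= 1 ->
  convex_hull A xi -> convex_hull A zeta ->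
  convex_hull A (t *: xi + (1 - t) *: zeta).
Proof.
move=> /andP[t0 t1] Axi Azeta B [Bc AB].
have := Bc xi zeta (Itv01 t0 t1).
rewrite !inE; apply; [exact: (Axi B)|exact: (Azeta B)].
Qed.

Lemma convex_hull_enorm_le A (L : R) : (forall xi, A xi -> enorm xi <= L) ->
  forall xi, convex_hull A xi -> enorm xi <= L.
Proof.
move=> AL xi /(_ [set z | enorm z <= L]); apply; split=> //.
move=> u v t; rewrite !inE/= => uL vL.
apply: le_trans (enormD _ _) _; rewrite !enormZ !ger0_norm// ?subr_ge0 ?le1//.
rewrite /unstable.onem.
have : 0 <= t%:num <= 1 by rewrite ge0 le1.
by move: t%:num => s /andP[s0 s1]; nra.
Qed.


(* A quantitative projection argument: an approximate minimiser of the norm on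
   [H] suffices, so [H] need not be closed. *)
Lemma convex_separation (H : set 'cV[R]_n) (L m : R) : H !=set0 -> 0 < m ->
  (forall xi zeta t, 0 <= t <= 1 -> H xi -> H zeta ->
    H (t *: xi + (1 - t) *: zeta)) ->
  (forall xi, H xi -> m <= enorm xi <= L) ->
  exists2 xi0, H xi0 &
    forall xi, H xi -> 3 / 4 * enorm xi0 ^+ 2 <= edot xi0 xi.
Proof.
move=> [xi1 Hxi1] m0 Hc Hb.
have L0 : 0 < L by have /andP[] := Hb _ Hxi1; lra.
pose E := [set enorm xi ^+ 2 | xi in H].
have Elb : lbound E (m ^+ 2).
  by move=> _ [xi /Hb/andP[mxi _] <-]; rewrite lerXn2r// nnegrE ?enorm_ge0// ltW.
have Einf : has_inf E by split; [exists (enorm xi1 ^+ 2), xi1|exists (m ^+ 2)].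
pose I := inf E.
have IE xi : H xi -> I <= enorm xi ^+ 2.
  by move=> Hxi; apply: ge_inf; [exact: Einf.2|exists xi].
have I0 : 0 < I.
  apply: (@lt_le_trans _ _ (m ^+ 2)); rewrite ?exprn_gt0//.
  by rewrite lb_le_inf//; exact: Einf.1.
have NL xi : H xi -> enorm xi ^+ 2 <= L ^+ 2.
  by move=> /Hb/andP[_ xiL]; rewrite lerXn2r// nnegrE ?enorm_ge0// ltW.
have L20 : 0 < L ^+ 2 by rewrite exprn_gt0.
(* With this [t] the quadratic term of the squared norm along the segment is at most [t * I / 4]. As
   [xi0] is optimal up to [t * I / 4], dividing by [t] gives
   [edot xi0 xi >= enorm xi0 ^+ 2 - I / 4], and [I <= enorm xi0 ^+ 2]. *)
pose t := I / (16 * L ^+ 2).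
have tI : 16 * t * L ^+ 2 = I by rewrite /t; field; rewrite gt_eqF.
have t0 : 0 < t by rewrite divr_gt0// mulr_gt0.
have t1 : t <= 1 by have := le_trans (IE _ Hxi1) (NL _ Hxi1); rewrite -tI; nra.
have [|_ [xi0 Hxi0 <-] xi0I] := @inf_adherent _ E (t * I / 4) _ Einf.
  by have := mulr_gt0 t0 I0; lra.
exists xi0 => // xi Hxi.
have := IE _ (Hc _ _ _ _ Hxi Hxi0); move=> /(_ t); rewrite (ltW t0) t1 => /(_ isT).
have N0 := NL _ Hxi0; have N1 := NL _ Hxi; have I1 := IE _ Hxi0.
have dL : edot xi xi0 >= - L ^+ 2.
  have := edot_le_enorm xi (- xi0); rewrite edotNr enormN.
  have := enorm_ge0 xi; have := enorm_ge0 xi0.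
  by have /andP[_] := Hb _ Hxi; have /andP[_] := Hb _ Hxi0; nra.
rewrite !enorm_sqr in N0 N1 I1 xi0I *.
rewrite !(edotDl, edotDr, edotZl, edotZr) (edotC xi0 xi) in dL *.
move: (edot xi xi) (edot xi xi0) (edot xi0 xi0) N0 N1 I1 xi0I dL => a b c.
rewrite -/I => N0 N1 I1 xi0I dL h.
have h1 : t * (t * (a - 2 * b + c)) <= t * (I / 4).
  by rewrite ler_pM2l// -tI; nra.
have h2 : 0 <= t * (2 * (b - c) + I / 2) by nra.
rewrite pmulr_rge0// in h2; lra.
Qed.

Variables (F : 'cV[R]_n -> R) (L : R).
Hypotheses (L0 : 0 <= L) (FL : forall u v, `|F u - F v| <= L * enorm (u - v)).

Lemma not_goldstein_descent (delta e : R) x : 0 < delta -> 0 < e ->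
  ~ goldstein_stationary F delta e x ->
  exists2 v, enorm v = 1 & F (x + delta *: v) - F x < - (e / 2) * delta.
Proof.
move=> delta0 e0 nst.
pose H := goldstein_subdifferential F delta x.
have clarkeH z xi : enorm (z - x) <= delta -> clarke_subdifferential F z xi -> H xi.
  by move=> zx Fxi; apply: sub_gen_smallest; exists z.
have HL xi : H xi -> e <= enorm xi <= L.
  move=> Hxi; apply/andP; split.
    by rewrite leNgt; apply/negP => /ltW xie; apply: nst; exists xi.
  apply: convex_hull_enorm_le Hxi => {}xi [z _].
  exact: (clarke_subdifferential_bound L0 FL).
have [xi1 Fxi1 _] := clarke_subdifferential_support FL x 0.
have H0 : H !=set0.
  by exists xi1; apply: clarkeH Fxi1;
    rewrite subrr -(scale0r 0) enormZ normr0 mul0r ltW.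
have [xi0 Hxi0 xi0H] := convex_separation H0 e0 (@convex_hull_segment _) HL.
have /andP[xi0e _] := HL _ Hxi0.
have xi0p : 0 < enorm xi0 by lra.
pose v := - (enorm xi0)^-1 *: xi0.
have v1 : enorm v = 1.
  by rewrite enormZ normrN ger0_norm ?invr_ge0 ?enorm_ge0// mulVf// gt_eqF.
exists v => //.
have Hv xi : H xi -> edot xi v <= - (3 / 4 * e).
  move=> /xi0H h; rewrite edotZr mulNr lerN2 [leRHS]mulrC ler_pdivlMr// edotC.
  by apply: le_trans h; nra.
pose phi t := F (x + t *: v).
have phiL s t : `|phi s - phi t| <= L * `|s - t|.
  apply: le_trans (FL _ _) _.
  by rewrite opprD addrACA subrr add0r -scalerBl enormZ v1 mulr1.
(* The rate [5 / 8 * e] lies strictly between the [3 / 4 * e] of the subgradients and the [e / 2] of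
   the conclusion; each gap makes one inequality strict. *)
have := @right_decrease_bound _ phi L (5 / 8 * e) delta delta0 L0 phiL.
rewrite /phi scale0r addr0 => h.
apply: (@le_lt_trans _ _ (- (5 / 8 * e) * delta)); last by nra.
apply: h => t /andP[t0 td].
(* The Clarke derivative along [v] is attained by a subgradient, which lies in [H] because the
   segment stays in the ball. *)
have [xi Fxi xiE] := clarke_subdifferential_support FL (x + t *: v) v.
have Hxi : H xi.
  by apply: clarkeH Fxi; rewrite addrAC subrr add0r enormZ v1 mulr1 ger0_norm// ltW.
have [|d d0 hd] := @clarke_derivative_lt _ _ F (x + t *: v) v (- (5 / 8 * e)).
  by rewrite -xiE lte_fin; have := Hv _ Hxi; lra.
exists d => // h' /andP[h0 hd'].
have := hd (x + t *: v) h'; rewrite subrr normr0 h0 hd' => /(_ d0 isT).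
by rewrite ler_pdivrMr// -addrA -scalerDl.
Qed.

End goldstein.

(** * Separation of mesh points *)

Section mesh.
Context {R : realType} {n : nat}.

(** A nonzero integer vector has an entry of modulus at least 1, and applying [invmx G] enlarges
    entries at most by the factor [C]. *)
Lemma lattice_separated (G : 'M[R]_n) : G \in unitmx ->
  exists2 c, 0 < c &
    forall z : 'cV[int]_n, z != 0 -> c <= enorm (G *m map_mx intr z).
Proof.
move=> GU.
pose C := 1 + \sum_i \sum_j `|invmx G i j|.
have s0 : 0 <= \sum_i \sum_j `|invmx G i j|.
  by apply: sumr_ge0 => i _; apply: sumr_ge0.
have C0 : 0 < C by rewrite /C; lra.
exists C^-1 => [|z z0]; first by rewrite invr_gt0.
set w := G *m _.
have zE : map_mx intr z = invmx G *m w by rewrite mulKmx.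
have [i zi] : exists i, z i 0 != 0.
  apply/existsP; apply: contraNT z0 => /existsPn h.
  by apply/eqP/colP => i; rewrite mxE; apply/eqP; have := h i; rewrite negbK.
rewrite -[leLHS]mul1r ler_pdivrMr//.
apply: (@le_trans _ _ `|(map_mx intr z : 'cV[R]_n) i 0|).
  by rewrite mxE -intr_norm ler1z -gtz0_ge1 normr_gt0.
rewrite zE mxE (le_trans (ler_norm_sum _ _ _))//.
apply: (@le_trans _ _ (\sum_j `|invmx G i j| * enorm w)).
  by apply: ler_sum => j _; rewrite normrM ler_wpM2l ?coord_le_enorm.
rewrite -mulr_suml mulrC ler_wpM2l ?enorm_ge0// /C [X in _ <= 1 + X](bigD1 i)//=.
have : 0 <= \sum_(i0 < n | i0 != i) \sum_j `|invmx G i0 j|.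
  by apply: sumr_ge0 => ? _; apply: sumr_ge0.
lra.
Qed.

(** Mesh displacements are [alpha] times points of the lattice [G Z^n], so [c] depends neither on
    [x] nor on [alpha]. *)
Lemma mesh_separated p (G : 'M[R]_n) (Zm : 'M[int]_(n, p)) : G \in unitmx ->
  exists2 c, 0 < c & forall x alpha t, 0 <= alpha ->
    mesh (G *m map_mx intr Zm) x alpha t -> t != x ->
    alpha * c <= enorm (t - x).
Proof.
move=> /lattice_separated[c c0 hc]; exists c => // x alpha _ alpha0 [m _ <-].
have -> : G *m map_mx intr Zm *m map_mx (fun k => k%:R) m =
    G *m map_mx intr (Zm *m map_mx Posz m).
  by rewrite map_mxM -mulmxA -map_mx_comp; congr (_ *m (_ *m _));
    apply/matrixP => i j; rewrite !mxE.
move: (Zm *m _) => z; rewrite -subr_eq0 (addrAC x) subrr add0r.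
have [->|z0 _] := eqVneq z 0; first by rewrite map_mx0 mulmx0 scaler0 eqxx.
by rewrite enormZ ger0_norm// ler_wpM2l// hc.
Qed.

End mesh.

(** * Recursions for the mesh and frame sizes *)

Section step_sizes.
Context {R : realType} (alpha Delta : nat -> R) (fail : nat -> Prop).
Variables (amin theta : R).
Hypotheses (amin0 : 0 < amin) (theta0 : 0 < theta) (theta1 : theta < 1).
Hypotheses (alpha0 : alpha 0%N = Delta 0%N) (Delta0 : amin <= Delta 0%N).
Hypothesis success : forall k, ~ fail k ->
  Delta k.+1 = theta^-1 * Delta k /\
  alpha k.+1 = Num.min (Delta k.+1) (Delta k.+1 ^+ 2).
Hypothesis failure : forall k, fail k ->
  Delta k.+1 = Num.max amin (theta * Delta k) /\
  alpha k.+1 = Num.min (Num.min (Delta k) (Delta k ^+ 2)) (theta * alpha k).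

Lemma frame_size_ge k : amin <= Delta k.
Proof.
have [am0 t0 t1] := And3 amin0 theta0 theta1.
elim: k => // k IH; have [/failure|/success] := pselect (fail k) => -[-> _].
  by rewrite le_max lexx.
by rewrite ler_pdivlMl//; nra.
Qed.

Lemma mesh_size_gt0 k : 0 < alpha k.
Proof.
have D0 j : 0 < Delta j := lt_le_trans amin0 (frame_size_ge j).
elim: k => [|k IH]; first by rewrite alpha0.
have [/failure|/success] := pselect (fail k) => -[_ ->].
  by rewrite !lt_min D0 exprn_gt0//= mulr_gt0.
by rewrite !lt_min D0 exprn_gt0.
Qed.

(* Above [max 1 amin] the mesh and frame sizes coincide, so bounded mesh sizes
   at successful iterations bound the frame sizes. *)
Lemma frame_size_bounded C : (forall k, ~ fail k -> alpha k <= C) ->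
  exists B, forall k, Delta k <= B.
Proof.
have [am0 t0 t1] := And3 amin0 theta0 theta1.
move=> aC.
pose b := Num.max 1 amin.
have b1 : 1 <= b by rewrite le_max lexx.
have ba : amin <= b by rewrite le_max lexx orbT.
have coincide k : Delta k <= b \/ alpha k = Delta k.
  elim: k => [|k IH]; first by right.
  have Dk := frame_size_ge k.
  have [/failure|/success] := pselect (fail k) => -[DE aE].
    rewrite DE; have [_|lt_a] := leP (theta * Delta k) amin; first by left.
    case: IH => [Db|aD]; first by left; nra.
    have [Db|ltD] := leP (Delta k) b; first by left; nra.
    by right; rewrite aE aD; apply/min_idPr; rewrite le_min; apply/andP; split; nra.
  have [D1|D1] := leP (Delta k.+1) 1; first by left; rewrite (le_trans D1).
  by right; rewrite aE; apply/min_idPl; nra.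
(* Only a success enlarges a frame above [amin], by [theta^-1]; just before it, [Delta k] is at most
   [b] or equals [alpha k <= C]. *)
pose B := Num.max (Delta 0%N) (theta^-1 * Num.max b C).
have BE : theta^-1 * Num.max b C <= B by rewrite le_max lexx orbT.
have Bb : b <= B.
  apply: le_trans BE; rewrite ler_pdivlMl//.
  have : b <= Num.max b C by rewrite le_max lexx.
  by nra.
exists B; elim=> [|k IH]; first by rewrite le_max lexx.
have Dk := frame_size_ge k.
have [/failure|sk] := pselect (fail k).
  by case=> -> _; rewrite ge_max (le_trans ba)//=; nra.
case: (success sk) => -> _; apply: le_trans BE.
rewrite ler_pM2l ?invr_gt0// le_max; case: (coincide k) => [->//|<-].
by rewrite aC ?orbT.
Qed.

(** A success makes [alpha] at least [a0] while frames stay below [C']. A failure either leaves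
    [alpha] above [a0] or shrinks it by exactly [theta], and then a frame above [amin] shrinks as
    well. Hence a small mesh forces the frame size down to [amin]. *)
Lemma frame_size_le_mesh_size C : (forall k, ~ fail k -> alpha k <= C) ->
  exists2 B, 0 < B & forall k, Delta k <= Num.max amin (B * alpha k).
Proof.
have [am0 t0 t1] := And3 amin0 theta0 theta1.
move=> /frame_size_bounded[C' DC'].
pose a0 := Num.min amin (amin ^+ 2).
have a00 : 0 < a0 by rewrite lt_min amin0 exprn_gt0.
have C'0 : 0 < C' := lt_le_trans amin0 (le_trans (frame_size_ge 0) (DC' 0%N)).
pose B := Num.max 1 (C' / a0).
have B1 : 1 <= B by rewrite le_max lexx.
have Ba0 : C' <= B * a0 by rewrite -ler_pdivrMr// le_max lexx orbT.
have B0 : 0 < B by lra.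
have min_ge j : a0 <= Num.min (Delta j) (Delta j ^+ 2).
  have Dj := frame_size_ge j.
  by rewrite le_min !ge_min Dj/= lerXn2r ?orbT// nnegrE ltW// (lt_le_trans amin0).
exists B => //; elim=> [|k IH].
  by rewrite le_max alpha0; apply/orP; right; have := frame_size_ge 0; nra.
have [fk|sk] := pselect (fail k); last first.
  have [_ aE] := success sk; rewrite le_max; apply/orP; right.
  by rewrite (le_trans (DC' _))// (le_trans Ba0)// ler_pM2l// aE min_ge.
have [DE aE] := failure fk.
move: IH; rewrite !le_max => /orP[Da|DB].
  rewrite DE ge_max lexx/= (_ : theta * Delta k <= amin)//.
  by have := frame_size_ge k; nra.
have [a1|] := leP a0 (alpha k.+1).
  by apply/orP; right; rewrite (le_trans (DC' _))// (le_trans Ba0)// ler_pM2l.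
rewrite aE gt_min ltNge min_ge/= => lt_a0.
rewrite (min_idPr (le_trans (ltW lt_a0) (min_ge k))).
rewrite DE mulrCA ge_max lexx/=; have [//|_] := leP (theta * Delta k) amin.
by rewrite ler_pM2l// DB.
Qed.

End step_sizes.

(** * Density of the directions of late iterations *)

Section dense_tail.
Context {R : realType}.

(** In dimension at least two, [v] is shifted by [t m] along a coordinate [j] other than a nonzero
    coordinate [i], then normalized. The ratio of these two coordinates ignores the normalization
    and determines [m]. *)
Lemma sphere_accumulation n (v : 'cV[R]_n.+2) (e : R) : enorm v = 1 -> 0 < e ->
  exists2 w : nat -> 'cV[R]_n.+2, injective w &
    forall m, enorm (w m) = 1 /\ enorm (w m - v) < e.
Proof.
move=> v1 e0.
have [i vi] : exists i, v i 0 != 0.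
  apply: contrapT => nv; have v0 : v = 0.
    apply/colP => i; rewrite mxE; apply: contrapT => /eqP vi.
    by apply: nv; exists i.
  move: v1 (oner_neq0 R); rewrite v0 -(scale0r 0) enormZ normr0 mul0r => ->.
  by rewrite eqxx.
pose j := lift i ord0; pose d : 'cV[R]_n.+2 := delta_mx j 0.
have d1 : enorm d = 1.
  rewrite /enorm /edot (bigD1 j)//= big1 => [|k kj]; rewrite !mxE.
    by rewrite !eqxx mulr1 addr0 sqrtr1.
  by rewrite (negbTE kj) mulr0.
have di : d i 0 = 0 by rewrite mxE (negbTE (neq_lift _ _)).
have dj : d j 0 = 1 by rewrite mxE !eqxx.
pose t m : R := e / m.+3%:R.
have t0 m : 0 < t m by rewrite divr_gt0.
have te m : t m * 2 < e.
  by rewrite /t mulrAC ltr_pdivrMr// ltr_pM2l// ltr_nat.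
pose u m := v + t m *: d.
have uE m k : u m k 0 = v k 0 + t m * d k 0 by rewrite !mxE.
have u0 m : enorm (u m) != 0.
  apply: contra vi => /eqP/enorm_eq0/colP/(_ i).
  by rewrite uE di mulr0 addr0 mxE => ->.
have up m : 0 < enorm (u m) by rewrite lt_def u0 enorm_ge0.
have u_le m : enorm (u m) <= 1 + t m.
  by rewrite (le_trans (enormD _ _))// v1 enormZ d1 mulr1 gtr0_norm.
have u_ge m : 1 - t m <= enorm (u m).
  have := enormD (u m) (- (t m *: d)).
  by rewrite addrK v1 enormN enormZ d1 mulr1 gtr0_norm//; lra.
exists (fun m => (enorm (u m))^-1 *: u m) => [m1 m2 eqw|m]; last first.
  rewrite enormZ gtr0_norm ?invr_gt0// mulVf//; split=> //.
  have -> : (enorm (u m))^-1 *: u m - v =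
      ((enorm (u m))^-1 - 1) *: u m + t m *: d.
    rewrite scalerBl scale1r -addrA; congr (_ + _).
    by rewrite /u opprD -addrA addNr addr0.
  rewrite (le_lt_trans (enormD _ _))// !enormZ d1 mulr1 (gtr0_norm (t0 m)).
  rewrite -{2}(gtr0_norm (up m)) -normrM mulrBl mulVf// mul1r.
  apply: (@le_lt_trans _ _ (t m * 2)) => //.
  have : `|1 - enorm (u m)| <= t m.
    by rewrite ler_norml; have := u_le m; have := u_ge m; lra.
  lra.
have wE m : ((enorm (u m))^-1 *: u m) j 0 / ((enorm (u m))^-1 *: u m) i 0 =
    (v j 0 + t m) / v i 0.
  have wE k : ((enorm (u m))^-1 *: u m) k 0 = (enorm (u m))^-1 * u m k 0.
    by rewrite mxE.
  rewrite !wE !uE di dj mulr0 addr0 mulr1 -mulf_div mulfV ?mul1r//.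
  by rewrite invr_eq0.
have := wE m1; rewrite eqw wE => /(mulIf _); rewrite invr_eq0 vi => /(_ isT).
move=> /addrI/(mulfI (lt0r_neq0 e0))/invr_inj/eqP.
by rewrite eqr_nat => /eqP[].
Qed.

Lemma finite_closed n (A : set 'cV[R]_n) : finite_set A -> closed A.
Proof.
by move: A; apply/accessible_finite_set_closed/hausdorff_accessible; exact: norm_hausdorff.
Qed.

Lemma finite_normalized_directions n (D : {fset 'cV[R]_n}) :
  finite_set (normalized_directions D).
Proof. by apply: finite_image; exact: finite_fset. Qed.

(** Otherwise, expanding [v] over [D] would give [edot v v <= 0]. *)
Lemma positive_spanning_edot_gt0 n (D : {fset 'cV[R]_n}) v :
  positive_spanning D -> enorm v = 1 -> exists2 d, d \in D & 0 < edot v d.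
Proof.
move=> /(_ v)[c c0 vE] v1; apply: contrapT => nD.
have : edot v v <= 0.
  rewrite {2}vE; rewrite big_seq.
  elim/big_rec: _ => [|d w dD IH]; first by rewrite edot0r.
  rewrite edotDr edotZr.
  have := c0 d dD.
  have : edot v d <= 0 by rewrite leNgt; apply/negP => h; apply: nD; exists d.
  by nra.
by rewrite -enorm_sqr v1 expr1n ler10.
Qed.

(* In dimension one the sphere has isolated points, and a dense union need not
   have a dense tail; positive spanning replaces density there. *)
Lemma dense_directions_tail n (K : set nat) (D : nat -> {fset 'cV[R]_n}) N :
  infinite_set K -> (forall k, K k -> positive_spanning (D k)) ->
  eunit_sphere R n `<=` closure (\bigcup_(k in K) normalized_directions (D k)) ->
  eunit_sphere R n `<=`
    closure (\bigcup_(k in K `&` [set k | (N <= k)%N]) normalized_directions (D k)).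
Proof.
move=> Kinf Dspan.
have [k [Kk Nk]] : K `&` [set k | (N <= k)%N] !=set0.
  apply/set0P/negP => /eqP K0; apply: Kinf; apply: sub_finite_set (finite_II N).
  move=> k Kk /=; rewrite ltnNge; apply/negP => Nk.
  by have : (K `&` [set k | (N <= k)%N]) k by []; rewrite K0.
case: n D Dspan => [|[|n]] D Dspan dense v v1.
- exfalso; move: v1 (oner_neq0 R).
  by rewrite /eunit_sphere/= /enorm /edot big_ord0 sqrtr0 => <-; rewrite eqxx.
(* On a line, a direction with positive product with [v] normalizes to [v], so one late index
   suffices. *)
- apply: subset_closure; exists k => //.
  have [d dD vd] := positive_spanning_edot_gt0 (Dspan _ Kk) v1.
  have dE : d = edot v d *: v.
    move: v1; rewrite /eunit_sphere/= => /(congr1 (fun r => r ^+ 2)).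
    rewrite enorm_sqr expr1n /edot !big_ord1 => vv.
    by apply/colP => i; rewrite mxE (ord1 i) mulrAC -mulrA mulrCA mulrA mulrC vv mulr1.
  exists d => //; rewrite {1 2}dE enormZ v1 mulr1 gtr0_norm//.
  by rewrite scalerA mulVf ?scale1r// gt_eqF.
- pose hd := \bigcup_(k in K `&` [set k | (k < N)%N]) normalized_directions (D k).
  set tl := \bigcup_(k in _) _.
  have hd_fin : finite_set hd.
    apply: bigcup_finite => [|l _]; last exact: finite_normalized_directions.
    by apply: sub_finite_set (finite_II N) => l [].
  have sub : eunit_sphere R n.+2 `<=` hd `|` closure tl.
    rewrite ((closure_id hd).1 (finite_closed hd_fin)) -closureU.
    apply: subset_trans dense _; apply: closureS => w [l Kl Dl].
    by have [lN|lN] := ltnP l N; [left|right]; exists l.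
  apply: contrapT => ntl.
  have /nbhs_normP[e /= e0 he] : nbhs v (~` closure tl).
    by apply: open_nbhs_nbhs; split=> //; exact/closed_openC/closed_closure.
  (* Infinitely many sphere points near [v] avoid the closure of the tail, yet the head [hd] is
     finite. *)
  have [w winj hw] := sphere_accumulation v1 e0.
  apply: infinite_nat; apply: sub_finite_set (finite_preimage _ hd_fin); last first.
    by move=> m1 m2 _ _; exact: winj.
  move=> m _ /=; have [wm1 wmv] := hw m.
  have [//|] := sub _ wm1.
  by move=> /(he (w m)); case; rewrite /ball_/= distrC (le_lt_trans (normr_le_enorm _)).
Qed.

Lemma cvg_within_lt (V : normedModType R) (K : set nat) (u : nat -> V) l (e : R) :
  u @ within K \oo --> l -> 0 < e ->
  exists N, forall k, (N <= k)%N -> K k -> `|u k - l| < e.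
Proof.
move=> /cvgrPdist_lt/[apply] -[N _ hN]; exists N => k Nk Kk.
by rewrite distrC; exact: hN.
Qed.

End dense_tail.

(** * Consequences for a run of the algorithm *)

Section run.
Context {R : realType} {n p : nat}.
Variables (Ft : 'cV[R]_n -> R) (x0 : 'cV[R]_n) (alpha_min : R) (theta : rat)
  (mu0 : nat) (G : 'M[R]_n) (Zm : 'M[int]_(n, p)) (x : nat -> 'cV[R]_n)
  (alpha Delta : nat -> R) (S D : nat -> {fset 'cV[R]_n}).
Hypothesis run :
  direct_search_run Ft x0 alpha_min theta mu0 G Zm x alpha Delta S D.
Hypothesis alpha_min0 : 0 < alpha_min.

Lemma run_success_step k : ~ unsuccessful Ft x alpha S D k ->
  Ft (x k.+1) < Ft (x k) /\
  mesh (G *m map_mx intr Zm) (x k) (alpha k) (x k.+1).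
Proof.
move=> nu; have [ss|nss] := pselect (search_success Ft (x k) (S k)).
  have [t tS [Ftt ->]] := run_search run ss.
  by split=> //; exact: (run_search_mesh run tS).
have [ps|nps] := pselect (poll_success Ft (x k) (alpha k) (D k)).
  have [d dD [Ftd ->]] := run_poll run nss ps.
  by split=> //; exact: (run_poll_mesh run nss dD).
by exfalso; apply: nu.
Qed.

Lemma run_nonincreasing k : Ft (x k) <= Ft x0.
Proof.
elim: k => [|k IH]; first by rewrite (run_x0 run).
apply: le_trans IH; have [u|nu] := pselect (unsuccessful Ft x alpha S D k).
  by rewrite (run_stay run u).
by rewrite ltW// (run_success_step nu).1.
Qed.

Let theta0 : 0 < ratr theta :> R.
Proof. by rewrite ltr0q; have /andP[] := run_theta run. Qed.

Let theta1 : ratr theta < 1 :> R.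
Proof. by rewrite -(rmorph1 (@ratr R)) ltr_rat; have /andP[] := run_theta run. Qed.

Let Delta0 : alpha_min <= Delta 0%N.
Proof.
rewrite (run_Delta0 run) (run_alpha0 run) ler_pdivlMr ?exprn_gt0//.
by rewrite ler_piMr ?exprn_ile1// ltW.
Qed.

Let alpha0 : alpha 0%N = Delta 0%N. Proof. by rewrite (run_Delta0 run). Qed.

Lemma run_mesh_size_gt0 k : 0 < alpha k.
Proof.
exact: (mesh_size_gt0 alpha_min0 theta0 theta1 alpha0 Delta0
  (run_update_success run) (run_update_failure run)).
Qed.

(** A success strictly decreases [Ft], hence moves to a different mesh point; separation then bounds
    [alpha k] by the diameter [2 * M] over [c]. *)
Lemma run_frame_size_le M : (forall k, enorm (x k) <= M) ->
  exists2 B, 0 < B & forall k, Delta k <= Num.max alpha_min (B * alpha k).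
Proof.
move=> xM; have [c c0 hc] := mesh_separated Zm (run_G run).
apply: (frame_size_le_mesh_size alpha_min0 theta0 theta1 alpha0 Delta0
  (run_update_success run) (run_update_failure run) (C := 2 * M / c)).
move=> k /run_success_step[lt_Ft mx].
rewrite ler_pdivlMr//.
have xx : x k.+1 != x k.
  by apply: contraTneq lt_Ft => ->; rewrite ltxx.
apply: le_trans (hc _ _ _ (ltW (run_mesh_size_gt0 k)) mx xx) _.
apply: le_trans (enormD _ _) _; rewrite enormN.
by have := xM k; have := xM k.+1; lra.
Qed.

Lemma run_frame_size_ge k : alpha_min <= Delta k.
Proof.
exact: (frame_size_ge alpha_min0 theta0 theta1 Delta0
  (run_update_success run) (run_update_failure run)).
Qed.

End run.

Unset Implicit Arguments.
Set Strict Implicit.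

Theorem theorem4p1 (R : realType) (nx ny : nat)
  (f g : 'cV[R]_nx * 'cV[R]_ny -> R) (Z : set 'cV[R]_ny)
  (y ytilde : 'cV[R]_nx -> 'cV[R]_ny) (eps Lf LF : R)
  (p : nat) (x0 : 'cV[R]_nx) (alpha_min : R) (theta : rat) (mu0 : nat)
  (G : 'M[R]_nx) (Zm : 'M[int]_(nx, p))
  (x : nat -> 'cV[R]_nx) (alpha Delta : nat -> R)
  (S D : nat -> {fset 'cV[R]_nx})
  (K : set nat) (xbar : 'cV[R]_nx) (b1 b2 : R -> R) :
  let F := objective f y in
  let Ft := objective f ytilde in
  continuous f ->
  (forall u, argmin_on (fun z => g (u, z)) Z = [set y u]) ->
  0 < eps ->
  (forall u, enorm (ytilde u - y u) <= eps) ->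
  0 < Lf ->
  (forall u v v', `|f (u, v) - f (u, v')| <= Lf * enorm (v - v')) ->
  (forall u u', `|F u - F u'| <= LF * enorm (u - u')) ->
  ebounded [set u | F u <= F x0 + 2 * Lf * eps] ->
  0 < alpha_min ->
  direct_search_run Ft x0 alpha_min theta mu0 G Zm x alpha Delta S D ->
  infinite_set K ->
  (forall k, K k -> unsuccessful Ft x alpha S D k) ->
  x @ within K \oo --> xbar ->
  alpha @ within K \oo --> (0 : R) ->
  eunit_sphere R nx `<=` closure (\bigcup_(k in K) normalized_directions (D k)) ->
  (forall t, 0 < t -> 0 < b1 t) ->
  (forall t, 0 < t -> 0 < b2 t) ->
  b1 t @[t --> 0^'+] --> (1 : R) ->
  b2 t @[t --> 0^'+] --> (1 : R) ->
  (forall k, polled Ft x S k -> forall d, d \in D k ->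
    Delta k / alpha k * b1 (alpha k) <= enorm d
      <= Delta k / alpha k * b2 (alpha k)) ->
  goldstein_stationary F alpha_min (4 * Lf * eps / alpha_min) xbar.
Proof.
move=> F Ft _ _ eps0 hyt Lf0 hf FLF [M hM] am0 run.
move=> Kinf Ku xK aK dense b10 b20 b1c b2c hD.
(* [LF] carries no sign assumption. *)
pose L := Num.max LF 0.
have L0 : 0 <= L by rewrite le_max lexx orbT.
have FL u v : `|F u - F v| <= L * enorm (u - v).
  by rewrite (le_trans (FLF u v))// ler_wpM2r ?enorm_ge0// le_max lexx.
have FFt u : `|Ft u - F u| <= Lf * eps.
  by apply: le_trans (hf _ _ _) _; rewrite ler_pM2l.
(* Exchanging [F] and [Ft] at [x k] and at [x0] costs [Lf * eps] each, so iterates stay in the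
   bounded level set. *)
have xM k : enorm (x k) <= M.
  apply: hM => /=; have := run_nonincreasing run k.
  have := FFt (x k); have := FFt x0; rewrite !ler_norml; lra.
have [B B0 hB] := run_frame_size_le run am0 xM.
have alpha0 := run_mesh_size_gt0 run am0.
have descent v : enorm v = 1 ->
    F xbar - 2 * Lf * eps <= F (xbar + alpha_min *: v).
  move=> v1; apply/ler_addgt0Pr => e e0.
  (* The final error is [L] times [eta + 2 * alpha_min * eta] at the poll point plus [L * eta] at
     [x k]. *)
  pose eta := e / (2 * L * (1 + alpha_min) + 1).
  have den0 : 0 < 2 * L * (1 + alpha_min) + 1 by nra.
  have eta0 : 0 < eta by rewrite divr_gt0.
  have etaE : eta * (2 * L * (1 + alpha_min) + 1) = e by rewrite divfK// gt_eqF.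
  pose eta' := eta / nx.+1%:R.
  have eta'0 : 0 < eta' by rewrite divr_gt0.
  have small (u : 'cV[R]_nx) : `|u| < eta' -> enorm u <= eta.
    move=> ueta; apply: le_trans (enorm_le_normr u) _.
    by rewrite mulrC -ler_pdivlMr// ltW.
  have [[e1 /= e10 he1] [e2 /= e20 he2]] :
      (\forall t \near 0^'+, `|1 - b1 t| < eta) /\
      (\forall t \near 0^'+, `|1 - b2 t| < eta).
    by split; [move/cvgrPdist_lt: b1c | move/cvgrPdist_lt: b2c]; exact.
  have [N1 hN1] := cvg_within_lt xK eta'0.
  (* The first bound makes [B * alpha k] less than [alpha_min], forcing [Delta k = alpha_min]; the
     others bring [b1] and [b2] within [eta] of 1. *)
  pose r := Num.min (alpha_min / B) (Num.min e1 e2).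
  have r0 : 0 < r by rewrite !lt_min divr_gt0//= e10.
  have [N2 hN2] := cvg_within_lt aK r0.
  have /(_ v v1 (ball v eta') (nbhsx_ballx _ _ eta'0)) :=
    dense_directions_tail (maxn N1 N2) Kinf
      (fun k Kk => run_poll_spanning run (Ku k Kk).1) dense.
  move=> [_ [[k [Kk Nk] [d dD <-]]]].
  rewrite -ball_normE /ball_ /= => /small vd.
  move: Nk; rewrite /= geq_max => /andP[Nk1 Nk2].
  have {}/small xk := hN1 k Nk1 Kk.
  have := hN2 k Nk2 Kk; rewrite subr0 gtr0_norm// /r !lt_min.
  rewrite ltr_pdivlMr// mulrC => /and3P[aB a1 a2].
  have Dk : Delta k = alpha_min.
    apply/eqP; rewrite eq_le (run_frame_size_ge run am0) andbT.
    by rewrite (le_trans (hB k))// ge_max lexx ltW.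
  have [pk npk] := Ku k Kk.
  have := hD k pk d dD; rewrite Dk => /andP[d1 d2].
  have b1k : `|1 - b1 (alpha k)| < eta.
    by apply: he1 => //=; rewrite sub0r normrN gtr0_norm.
  have b2k : `|1 - b2 (alpha k)| < eta.
    by apply: he2 => //=; rewrite sub0r normrN gtr0_norm.
  have Ftk : Ft (x k) <= Ft (x k + alpha k *: d).
    by rewrite leNgt; apply/negP => h; apply: npk; exists d.
  have d0 : 0 < enorm d.
    by apply: lt_le_trans d1; rewrite mulr_gt0 ?b10// divr_gt0.
  (* In the length of the poll step [alpha k] cancels, leaving [alpha_min] times a factor near 1. *)
  pose s := alpha k * enorm d.
  have s_near : `|alpha_min - s| <= alpha_min * eta.
    have sE b : alpha k * (alpha_min / alpha k * b) = alpha_min * b.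
      by field; rewrite gt_eqF.
    have s1 : alpha_min * b1 (alpha k) <= s by rewrite -sE ler_pM2l.
    have s2 : s <= alpha_min * b2 (alpha k) by rewrite -sE ler_pM2l.
    move: b1k b2k; rewrite ler_norml !ltr_norml => /andP[_ h1] /andP[h2 _].
    by apply/andP; split; nra.
  pose w := (enorm d)^-1 *: d.
  have w1 : enorm w = 1 by rewrite enormZ gtr0_norm ?invr_gt0// mulVf// gt_eqF.
  have dw : alpha k *: d = s *: w.
    by rewrite scalerA /s mulfK// gt_eqF.
  rewrite -/w in vd; clearbody w.
  have close : enorm (xbar + alpha_min *: v - (x k + alpha k *: d)) <=
      eta + 2 * alpha_min * eta.
    (* The three errors come from base point, direction and length. *)
    have -> : xbar + alpha_min *: v - (x k + alpha k *: d) =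
        - (x k - xbar) + (alpha_min *: (v - w) + (alpha_min - s) *: w).
      rewrite dw scalerBr scalerBl opprB opprD addrACA; congr (_ + _).
      by rewrite addrA subrK.
    apply: le_trans (enormD _ _) _; rewrite enormN.
    have := enormD (alpha_min *: (v - w)) ((alpha_min - s) *: w).
    rewrite !enormZ w1 mulr1 (gtr0_norm am0).
    have : alpha_min * enorm (v - w) <= alpha_min * eta by rewrite ler_pM2l.
    by move: xk s_near; lra.
  have /ler_normlP[_ h1] := FL (xbar + alpha_min *: v) (x k + alpha k *: d).
  have /ler_normlP[h1' _] := FL (xbar + alpha_min *: v) (x k + alpha k *: d).
  have /ler_normlP[h2 _] := FL (x k) xbar.
  have h3 := ler_wpM2l L0 close; have h4 := ler_wpM2l L0 xk.
  have := FFt (x k); have := FFt (x k + alpha k *: d); rewrite !ler_norml.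
  have : L * (eta + 2 * alpha_min * eta) + L * eta <= e.
    by rewrite -etaE; nra.
  by lra.
apply: contrapT => nst.
have [|v v1] := not_goldstein_descent L0 FL am0 _ nst.
  by rewrite divr_gt0// !mulr_gt0.
apply/negP; rewrite -leNgt.
(* The factor 4 in the tolerance makes the guaranteed descent match the oracle error
   [2 * Lf * eps]. *)
have -> : - (4 * Lf * eps / alpha_min / 2) * alpha_min = - (2 * Lf * eps).
  by field; rewrite gt_eqF.
by have := descent v v1; lra.
Qed.
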